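(* Let $G \in \mathcal{H}$ with vertex bipartition $\{V_{\alpha}(G), V_{\beta}(G)\}$. For every vertex $v \in V_{\beta}(G)$, every colour $c \in \{1,2\}$ and every $2$-colouring $a: V_{\alpha}(G) \rightarrow \{1, 2\}$ there exists a $2$-colouring $b: V_{\beta}(G) \rightarrow \{1, 2\}$ satisfying the following conditions: (1) no cycle in $G$ is monochromatic with respect to $a \triangledown b$; (2) if a path in $G$ has both ends of type $\beta$ and all its inner vertices are of degree $2$ in $G$, then its vertices of type $\beta$ are coloured $1$ and $2$ alternately (along the path) by $b$; (3) $b(v) = c$.
   Context: All graphs are finite and simple. $\mathcal{H}$ is the family of all graphs in which every cycle has length congruent to $0$ modulo $4$; every such graph is bipartite. A vertex bipartition $\{V_{\alpha}(G), V_{\beta}(G)\}$ of $G$ is a partition of $V(G)$ into two independent sets; vertices in $V_{\alpha}(G)$ are of type $\alpha$ and vertices in $V_{\beta}(G)$ of type $\beta$. Colourings are arbitrary maps (not necessarily proper). For $a: V_{\alpha}(G) \to \{1,2\}$ and $b: V_{\beta}(G) \to \{1,2\}$, the $2$-colouring $a \triangledown b : V(G) \to \{1,2\}$ is defined by $a \triangledown b(w) = a(w)$ for $w \in V_{\alpha}(G)$ and $a \triangledown b(w) = b(w)$ for $w \in V_{\beta}(G)$. A cycle is monochromatic with respect to $a \triangledown b$ if all its vertices have the same colour. *)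

(* Defs.v *)
(* A finite simple graph is a symmetric irreflexive relation
   [e : rel T] on a finite type [T] of vertices. *)
From mathcomp Require Import all_boot.
Set Implicit Arguments.
Unset Strict Implicit.
Unset Printing Implicit Defensive.

(* The bound [2 < size c] is needed because [ucycle] also accepts the empty
   sequence and, when [e] is symmetric, a single edge [:: x; y]. *)
Definition is_cycle (T : finType) (e : rel T) (c : seq T) : Prop :=
  ucycle e c /\ 2 < size c.

Definition in_H (T : finType) (e : rel T) : Prop :=
  forall c : seq T, is_cycle e c -> 4 %| size c.

Definition independent (T : finType) (e : rel T) (A : {set T}) : Prop :=
  {in A &, forall x y, ~~ e x y}.

(* One of the two classes may be empty (if the graph has no edges). *)
Definition is_bipartition (T : finType) (e : rel T) (A B : {set T}) : Prop :=
  [/\ A :|: B = [set: T], [disjoint A & B], independent e A & independent e B].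

Definition degree (T : finType) (e : rel T) (x : T) : nat := #|[set y | e x y]|.

(* The colours 1 and 2 are the two elements of ['I_2]. *)
Definition colouring (T : finType) (A : {set T}) : Type :=
  {x : T | x \in A} -> 'I_2.

(* The last default value is never reached when [A] and [B] cover [T]. *)
Definition join_colouring (T : finType) (A B : {set T})
    (a : colouring A) (b : colouring B) (w : T) : 'I_2 :=
  if (insub w : option {x : T | x \in A}) is Some x then a x
  else if (insub w : option {x : T | x \in B}) is Some y then b y
  else ord0.

Definition monochromatic (T : finType) (f : T -> 'I_2) (c : seq T) : Prop :=
  constant [seq f w | w <- c].

(* A path is given, as in [path], by its first vertex [x] and the sequence [p]
   of the following ones; its vertices are distinct. *)
Definition is_path (T : finType) (e : rel T) (x : T) (p : seq T) : Prop :=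
  path e x p /\ uniq (x :: p).

Definition inner_vertices (T : finType) (x : T) (p : seq T) : seq T :=
  behead (belast x p).

(* [pmap insub] extracts from the path the subsequence of its vertices in [B];
   there are only two colours, so they alternate exactly when consecutive
   elements of this subsequence have different colours. *)
Definition alternates_along (T : finType) (B : {set T}) (b : colouring B)
    (x : T) (p : seq T) : Prop :=
  sorted (fun y z => b y != b z)
    (pmap (insub : T -> option {x : T | x \in B}) (x :: p)).

(* Main.v *)
Require Import Defs.
From mathcomp Require Import all_boot zify.
Set Implicit Arguments.
Unset Strict Implicit.
Unset Printing Implicit Defensive.

(** The condition on paths only says that the two neighbours of each vertex of
    degree 2 in [Va] have different colours. These constraints can be satisfied,
    since a cycle of constraints is a cycle of the graph, of length divisible
    by 4, hence consists of an even number of constraints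
    ([separating_colouring]).

    To avoid monochromatic cycles as well, suppose first that the graph has no
    separation at a vertex. No cycle has a chord, because the two cycles into
    which it would cut the first one would also have lengths divisible by 4
    ([cycle_no_chord]). The classical theory of minimally 2-connected graphs
    then shows that every cycle has at least two vertices of degree 2
    ([cycle_degree2]): among the ears of the cycle, consider the shortest arcs
    that they span, and reroute the cycle along two crossing ears to obtain a
    chord. A vertex of degree 2 in [Va] has differently coloured neighbours and
    destroys the cycle. A vertex of degree 2 in [Vb] is either next to such a
    vertex or subject to no constraint, and then it can be given the colour
    opposite to that of its neighbours when these agree. As there are two
    vertices of degree 2, one of them is not [v], and the prescribed colour of
    [v] does no harm ([good_inseparable]).

    In general, split the graph at a separating vertex. Every cycle lies on one
    side, and the colourings of the two sides can be matched by prescribing the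
    colour of one vertex of the second side ([good_glue]). *)

(** * Chords and ears of a cycle *)

Lemma is_cycle_rot (T : finType) (e : rel T) n (c : seq T) :
  is_cycle e (rot n c) <-> is_cycle e c.
Proof. by rewrite /is_cycle rot_ucycle size_rot. Qed.

(** A nonempty side [D] of the graph, attached to the rest through the single
    vertex [x]; both sides contain an edge. [D] is a union of components of the
    graph minus [x], so disconnected graphs are covered too. *)
Definition separation (T : finType) (e : rel T) (D : {set T}) (x : T) : bool :=
  [&& x \notin D,
      [forall y in D, forall z, e y z ==> (z \in D) || (z == x)],
      [exists y in D, exists z, e y z]
    & [exists y, exists z, [&& y \notin D, z \notin D & e y z]]].

Section Ears.

Variables (T : finType) (e : rel T).
Hypotheses (e_sym : symmetric e) (eH : in_H e).

(** The chord cuts the cycle into two cycles. Their lengths add up to that of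
    the whole cycle plus 2, so the three cannot all be multiples of 4. *)
Lemma cycle_no_chord x s1 y s2 :
    is_cycle e (x :: s1 ++ y :: s2) -> s1 != [::] -> s2 != [::] -> ~~ e x y.
Proof.
move=> xsys s1n s2n; apply/negP => exy; have eyx : e y x by rewrite e_sym.
case: (xsys) => /andP[ecyc euniq] _.
have [p1 p2 p3] : [/\ path e x s1, e (last x s1) y & path e y (rcons s2 x)].
  by move: ecyc; rewrite /= rcons_cat cat_path /= => /and3P.
have {}s1n : 0 < size s1 by case: (s1) s1n.
have {}s2n : 0 < size s2 by case: (s2) s2n.
have cyc1 : is_cycle e (x :: rcons s1 y).
  split; last by rewrite /= size_rcons !ltnS.
  rewrite /ucycle /= !rcons_path last_rcons p1 p2 eyx /=.
  by move: euniq; rewrite -cat_rcons -cat_cons cat_uniq => /andP[].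
have cyc2 : is_cycle e (y :: rcons s2 x).
  split; last by rewrite /= size_rcons !ltnS.
  rewrite /ucycle /= rcons_path last_rcons p3 exy /=.
  have : uniq (y :: s2 ++ x :: s1) by rewrite -cat_cons uniq_catC.
  by rewrite -cat_rcons -cat_cons cat_uniq => /andP[].
move: (eH cyc1) (eH cyc2) (eH xsys).
rewrite /= !size_rcons size_cat /=; lia.
Qed.

Definition edge_off (c : seq T) : rel T :=
  [rel y z | [&& e y z, y \notin c & z \notin c]].

(** Membership in the neighbourhood, on [c], of the component of [z] in the
    graph minus [c]: these are the attachments of a bridge of [c]. *)
Definition attached (c : seq T) (z x : T) : bool :=
  [&& x \in c, z \notin c & [exists y, connect (edge_off c) z y && e y x]].

Lemma off_connect_sym c : connect_sym (edge_off c).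
Proof.
apply: sym_connect_sym => y z.
by rewrite /edge_off /= e_sym [(y \notin c) && _]andbC.
Qed.

Lemma connect_off_notin c y z :
  y \notin c -> connect (edge_off c) y z -> z \notin c.
Proof.
move=> yc /connectP[p pth ->]; elim: p y yc pth => //= w p IHp y _.
by case/andP=> /and3P[_ _ wc]; apply: IHp.
Qed.

Lemma attached_ear c z x y : attached c z x -> attached c z y ->
  exists p, [/\ path e x (rcons p y), p != [::], uniq p
              & {in p, forall w, connect (edge_off c) z w && (w \notin c)}].
Proof.
case/and3P=> _ zc /existsP[x' /andP[zx' ex'x]].
case/and3P=> _ _ /existsP[y' /andP[zy' ey'y]].
have x'c := connect_off_notin zc zx'.
have : connect (edge_off c) x' y'.
  by apply: connect_trans zy'; rewrite off_connect_sym.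
case/connectP=> p0 /shortenP[p pth unip _] y'p.
exists (x' :: p); split=> //.
  rewrite /= e_sym ex'x rcons_path -y'p ey'y andbT.
  by apply: sub_path pth => u w /and3P[].
have x'p w : w \in x' :: p -> connect (edge_off c) x' w.
  exact: path_connect pth w.
move=> w /x'p x'w; rewrite (connect_trans zx' x'w) /=.
exact: connect_off_notin x'c x'w.
Qed.

(** An ear from [x] to the next vertex [y] would replace the edge [x y] of the
    cycle, which would then become a chord of the longer cycle. *)
Lemma attached_not_consecutive c z x y s :
  is_cycle e (x :: y :: s) -> c =i x :: y :: s ->
  attached c z x -> ~~ attached c z y.
Proof.
move=> cyc cE zx; apply/negP => zy.
have [p [pth pn unip pc]] := attached_ear zx zy.
case: (cyc) => /andP[/andP[exy ecyc] uxys] sz.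
have ys : path e y (rcons s x) := ecyc.
suff cyc' : is_cycle e (x :: p ++ y :: s).
  by apply/negP: exy; apply: cycle_no_chord cyc' pn _; case: (s) sz.
split; last first.
  by case: (p) pn => //= ? ? _; rewrite size_cat /=; lia.
have -> : ucycle e (x :: p ++ y :: s) = uniq (x :: p ++ y :: s).
  rewrite /ucycle /= rcons_cat rcons_cons -cat_rcons.
  by rewrite cat_path last_rcons pth ys.
rewrite -cat1s uniq_catCA cat_uniq unip uxys andbT.
by apply/hasPn => w; rewrite -cE => wc; apply/negP => /pc; rewrite wc andbF.
Qed.

(** Two disjoint ears [x .. y] and [x' .. y'] that cross, with [x] and [x']
    consecutive, would give a cycle with chord [x x']: follow the first ear from
    [x] to [y], the cycle back to [x'], the second ear to [y'], and the cycle on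
    to [x]. The two ears are disjoint unless they run in the same component of
    the graph minus the cycle. *)
Lemma attached_not_crossing c z z' x x' B y F1 y' F2 :
    let cyc := x :: x' :: B ++ y :: F1 ++ y' :: F2 in
    is_cycle e cyc -> c =i cyc ->
    attached c z x -> attached c z y -> attached c z' x' -> attached c z' y' ->
  connect (edge_off c) z z'.
Proof.
move=> cyc cycP cE zx zy zx' zy'; apply/idPn => nzz'.
have [p [pth pn unip pc]] := attached_ear zx zy.
have [q [qth qn uniq_q qc]] := attached_ear zx' zy'.
case: (cycP) => /andP[ecyc ucyc] _.
have ucyc' : uniq (p ++ q ++ cyc).
  rewrite !(cat_uniq, has_cat) unip uniq_q ucyc negb_or -!andbA andbT andTb.
  apply/and3P; split; apply/hasPn => w.
  - move=> /qc/andP[z'w _]; apply/negP => /pc/andP[zw _]; case/negP: nzz'.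
    by apply: connect_trans zw _; rewrite off_connect_sym.
  - by rewrite -cE => wc; apply/negP => /pc; rewrite wc andbF.
  - by rewrite -cE => wc; apply/negP => /qc; rewrite wc andbF.
move: ecyc; rewrite /cyc /= rcons_cat /= -cat_rcons cat_path rcons_cat /=.
rewrite !cat_path last_rcons /= => /and5P[exx' Bpth _ _ F2pth].
(* The cycle with chord [x x'] described above. *)
pose new := x :: (p ++ y :: rev B) ++ x' :: (q ++ y' :: F2).
suff newP : is_cycle e new.
  by apply/negP: exx'; apply: cycle_no_chord newP _ _; [case: (p) | case: (q)].
split; last by rewrite /= size_cat /= size_cat /= !addnS.
rewrite /ucycle; apply/andP; split.
  have revB : path e y (rcons (rev B) x').
    have := rev_path e x' (rcons B y);
    rewrite last_rcons belast_rcons rev_cons => ->.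
    by rewrite (eq_path (e' := e)) // => u w; rewrite e_sym.
  have newE : rcons ((p ++ y :: rev B) ++ x' :: (q ++ y' :: F2)) x
    = rcons p y ++ rcons (rev B) x' ++ rcons q y' ++ rcons F2 x.
    by rewrite !cat_rcons rcons_cat rcons_cons rcons_cat -catA.
  rewrite -[cycle e new]/(path e x (rcons (_ ++ _ :: (_ ++ _)) x)) newE.
  by rewrite !cat_path !last_rcons pth revB qth F2pth.
have : uniq (p ++ q ++ (x :: x' :: B ++ y :: y' :: F2)).
  apply: subseq_uniq ucyc'; rewrite !cat_subseq //=.
  rewrite !eqxx cat_subseq //= eqxx.
  exact: suffix_subseq.
congr is_true; apply/esym/perm_uniq; clear; apply/permP => a.
rewrite /= !count_cat /= !count_cat /= count_rev; lia.
Qed.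

Hypothesis e_irrefl : irreflexive e.
Hypothesis e_insep : forall D x, ~~ separation e D x.

(** A third neighbour [z] of [x] is off the cycle, as there are no chords. If
    the component of [z] in the graph minus the cycle met the cycle at [x] only,
    this component would be one side of a separation at [x]. *)
Lemma attached_twice c x : is_cycle e c -> x \in c -> degree e x != 2 ->
  exists z y, [/\ attached c z x, y != x & attached c z y].
Proof.
move=> cycP xc; have [i s defc] := rot_to xc.
have cE w : (w \in c) = (w \in x :: s) by rewrite -(mem_rot i) defc.
move: (cycP); rewrite -(is_cycle_rot e i) defc.
case: s cE {defc} => [|y s] cE; first by case.
case/lastP: s cE => [|s y'] cE; first by case.
move=> cycP'; have [/andP[]] := cycP'.
rewrite /= rcons_path last_rcons => /and3P[exy _ ey'x].
rewrite inE mem_rcons => /and3P[_ + _] _.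
rewrite mem_rcons inE negb_or => /andP[yy' _] degx.
have /subsetPn[z] : ~~ ([set z | e x z] \subset [set y; y']).
  apply: contra degx => sub; rewrite /degree; apply/eqP.
  suff -> : [set z | e x z] = [set y; y'] by rewrite cards2 yy'.
  apply/eqP; rewrite eqEsubset sub; apply/subsetP => w.
  by rewrite !inE => /orP[] /eqP -> //; rewrite e_sym.
rewrite !inE negb_or => exz /andP[zy zy'].
have zc : z \notin c.
  rewrite cE !inE mem_rcons inE !negb_or zy zy' /=.
  apply/andP; split; first by apply: contraTneq exz => ->; rewrite e_irrefl.
  apply/negP => zs; case/splitPr: zs cycP' {cE} => s1 s2.
  rewrite rcons_cat rcons_cons -(cat_cons y) => cycP'.
  by apply/negP: exz; apply: cycle_no_chord cycP' _ _ => //; case: (s2).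
have zx : attached c z x.
  by rewrite /attached xc zc; apply/existsP; exists z; rewrite connect0 e_sym.
case: (altP (@existsP _ (fun m => (m != x) && attached c z m))) => [[m]|none].
  by case/andP=> mx zm; exists z, m.
pose D := [set w | connect (edge_off c) z w].
have xD : x \notin D.
  by apply: contraL xc; rewrite inE => /(connect_off_notin zc).
case/negP: (e_insep D x); apply/and4P; split=> //.
- apply/'forall_implyP => w wD; apply/forallP => t; apply/implyP => ewt.
  have zw : connect (edge_off c) z w by rewrite inE in wD.
  case: (boolP (t \in c)) => tc; last first.
    rewrite inE; apply/orP; left; apply: (connect_trans zw); apply: connect1.
    by rewrite /edge_off /= ewt tc (connect_off_notin zc zw).
  apply/orP; right; apply: contraR none => tx; apply/existsP; exists t.
  by rewrite tx /attached tc zc; apply/existsP; exists w; rewrite zw.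
- apply/existsP; exists z; rewrite inE connect0.
  by apply/existsP; exists x; rewrite e_sym.
apply/existsP; exists x; apply/existsP; exists y; rewrite xD exy andbT /=.
rewrite inE; apply/negP => /(connect_off_notin zc).
by rewrite cE !inE eqxx orbT.
Qed.

(** Induction on the length of the arc between two attachments [x] and [y] of a
    same component. If the first vertex [x'] of the arc does not have degree 2,
    it is the end of an ear, whose other end is not [x], since ears do not join
    consecutive vertices, and is not outside the arc, since it would cross an
    ear from [x] to [y]. Hence it cuts off a shorter arc. *)
Lemma ear_arc_degree2 c A x B y F z :
    is_cycle e c -> c = A ++ x :: B ++ y :: F ->
    attached c z x -> attached c z y ->
  exists2 w, w \in B & degree e w = 2.
Proof.
move=> cycP; elim: {B}(size B) {-2}B (leqnn (size B)) A x y F z => [|n IHn] B.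
  rewrite leqn0 => /nilP-> A x y F z defc zx zy.
  have rotc : rot (size A) c = x :: y :: F ++ A by rewrite defc rot_size_cat.
  have cE : c =i x :: y :: F ++ A by move=> w; rewrite -rotc mem_rot.
  have cycP' : is_cycle e (x :: y :: F ++ A) by rewrite -rotc is_cycle_rot.
  by have := attached_not_consecutive cycP' cE zx; rewrite zy.
case: B => [_|x' B]; first exact: IHn.
rewrite [size _]/= ltnS => sB A x y F z defc zx zy.
have [deg|deg] := eqVneq (degree e x') 2; first by exists x'; rewrite ?mem_head.
have x'c : x' \in c by rewrite defc mem_cat !inE eqxx !orbT.
have [z' [m [z'x' mx' z'm]]] := attached_twice cycP x'c deg.
have rotc : rot (size A) c = x :: x' :: B ++ y :: F ++ A.
  by rewrite defc rot_size_cat /= -catA.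
have cE : c =i x :: x' :: B ++ y :: F ++ A by move=> w; rewrite -rotc mem_rot.
have cycP' : is_cycle e (x :: x' :: B ++ y :: F ++ A).
  by rewrite -rotc is_cycle_rot.
have consecutive t : attached c t x -> ~~ attached c t x'.
  exact: attached_not_consecutive cycP' cE.
have [mB|mB] := boolP (m \in B).
  case/splitPr: mB defc sB {rotc cE cycP' consecutive} => B1 B2 defc sB.
  have sB1 : size B1 <= n by apply: leq_trans sB; rewrite size_cat leq_addr.
  case: (IHn B1 sB1 (rcons A x) x' m (B2 ++ y :: F) z') => //.
    by rewrite defc cat_rcons /= -catA.
  by move=> w wB1 degw; exists w; rewrite // inE mem_cat wB1 orbT.
have [my|my] := eqVneq m y.
  case: (IHn B sB (rcons A x) x' y F z') => //; last first.
  - by move=> w wB degw; exists w; rewrite // inE wB orbT.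
  - by rewrite -my.
  - by rewrite defc cat_rcons.
have [mx|mx] := eqVneq m x.
  by have := consecutive z'; rewrite -mx z'm z'x' => /(_ isT).
have : m \in F ++ A.
  have := z'm; rewrite /attached cE => /andP[+ _].
  by rewrite !(inE, mem_cat) (negPf mx) (negPf mx') (negPf mB) (negPf my).
move=> mFA; case/splitPr: mFA cE cycP' => F1 F2 cE cycP'.
have zz' := attached_not_crossing cycP' cE zx zy z'x' z'm.
suff zx' : attached c z x' by have := consecutive z zx; rewrite zx'.
have /and3P[_ z'c /existsP[t /andP[z't etx']]] := z'x'.
have /and3P[_ zc _] := zx.
rewrite /attached x'c zc; apply/existsP; exists t.
by rewrite (connect_trans zz' z't).
Qed.

(** Every cycle has at least two vertices of degree 2: start the cycle at [v];
    if its second vertex does not have degree 2, an ear leaves from it, and it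
    cannot end at [v], the vertex just before. The arc that this ear spans then
    avoids [v]. *)
Lemma cycle_degree2 c v : is_cycle e c ->
  exists2 w, w \in c & (w != v) && (degree e w == 2).
Proof.
move=> cycP.
have [i [x0 [x1 [s [defc vc]]]]] : exists i x0 x1 s,
    rot i c = x0 :: x1 :: s /\ v \notin x1 :: s.
  have [vc|vc] := boolP (v \in c).
    have [i [|x1 s] defc] := rot_to vc.
      by move: cycP; rewrite -(is_cycle_rot e i) defc => -[].
    exists i, v, x1, s; split=> //.
    move: cycP; rewrite -(is_cycle_rot e i) defc => -[/andP[_]].
    by rewrite cons_uniq => /andP[].
  case: c cycP vc => [|x0 [|x1 s]] [_] // _; rewrite inE negb_or => /andP[_ vs].
  by exists 0, x0, x1, s; rewrite rot0.
have {}cycP : is_cycle e (x0 :: x1 :: s) by rewrite -defc is_cycle_rot.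
have [w wc degw] : exists2 w, w \in x1 :: s & degree e w = 2.
  have [deg|deg] := eqVneq (degree e x1) 2.
    by exists x1; rewrite ?mem_head.
  have x1c : x1 \in x0 :: x1 :: s by rewrite !inE eqxx orbT.
  have [z [m [zx1 mx1 zm]]] := attached_twice cycP x1c deg.
  have [mx0|mx0] := eqVneq m x0.
    rewrite mx0 in zm.
    by have := attached_not_consecutive cycP (fun=> erefl) zm; rewrite zx1.
  have ms : m \in s by have /andP[] := zm; rewrite !inE (negPf mx0) (negPf mx1).
  case/splitPr: ms {vc defc} cycP zx1 zm => B F cycP zx1 zm.
  have [w wB degw] := ear_arc_degree2 (A := [:: x0]) cycP erefl zx1 zm.
  by exists w; rewrite // inE mem_cat wB orbT.
exists w; first by rewrite -(mem_rot i) defc inE wc orbT.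
by rewrite degw eqxx andbT; apply: contraNneq vc => <-.
Qed.

End Ears.

(** * Separating the two neighbours of each vertex of degree 2 *)

Section Colourings.

Variable T : finType.
Implicit Types (e : rel T) (A D : {set T}) (a b f : T -> bool).

(** Here the first class of the bipartition is a set [A] and the second one is
    its complement; colours are booleans, and a colouring of one class is a
    function on all vertices whose values on the other class are ignored. *)
Definition crosses e A := forall x y, e x y -> (x \in A) != (y \in A).

(** The local form of the alternation of colours along threads. *)
Definition separates e A f := forall w u u', w \in A -> u != u' ->
  [set z | e w z] = [set u; u'] -> f u != f u'.

Lemma degree2_neighbours e w u u' : degree e w = 2 -> e w u -> e w u' ->
  u != u' -> [set z | e w z] = [set u; u'].
Proof.
move=> deg ewu ewu' uu'; apply/esym/eqP; rewrite eqEcard cards2 uu' -deg leqnn.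
by rewrite andbT; apply/subsetP => z; rewrite !inE => /orP[] /eqP ->.
Qed.

Lemma neighbours_degree2 e w u u' :
  u != u' -> [set z | e w z] = [set u; u'] -> degree e w = 2.
Proof. by move=> uu'; rewrite /degree => ->; rewrite cards2 uu'. Qed.

Lemma cycle_neighbours e c y : symmetric e -> is_cycle e c -> y \in c ->
  exists u u', [/\ u \in c, u' \in c, u != u', e y u & e y u'].
Proof.
move=> e_sym cycP yc; have [i s defc] := rot_to yc.
have cE w : (w \in c) = (w \in y :: s) by rewrite -(mem_rot i) defc.
move: cycP; rewrite -(is_cycle_rot e i) defc.
case: s cE {defc} => [|u s] cE; first by case.
case/lastP: s cE => [|s u'] cE; first by case.
case=> /andP[]; rewrite /= rcons_path last_rcons => /and3P[eyu _ eu'y].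
move=> /and3P[_ + _] _; rewrite mem_rcons inE negb_or => /andP[uu' _].
by exists u, u'; rewrite !cE !(inE, mem_rcons) !eqxx !orbT (e_sym y u').
Qed.

Lemma in_H_sub e e' : subrel e' e -> in_H e -> in_H e'.
Proof.
move=> sub eH c [/andP[cyc unic] sz]; apply: eH; split=> //.
by apply/andP; split=> //; apply: sub_cycle cyc.
Qed.

(** The colour changes at each vertex of [A], hence every two steps. *)
Lemma alternation_along_path e A (W : {set T}) f x p :
    symmetric e -> crosses e A ->
    W \subset [set w in A | degree e w == 2] -> separates e W f ->
    path [rel y z | e y z && ((y \in W) || (z \in W))] x p -> uniq (x :: p) ->
    x \notin A -> last x p \notin A ->
  [/\ {in p, forall y, y \in A -> y \in W}, ~~ odd (size p)
    & f (last x p) = f x (+) odd (size p)./2].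
Proof.
move=> e_sym eA WA fW pth unip.
have [n] := ubnP (size p); elim: n x p pth unip => // n IHn x [|w [|t p]] //=.
- by rewrite addbF.
- rewrite andbT => /andP[exw _] _ _ xA wA.
  by have := eA _ _ exw; rewrite (negPf xA) (negPf wA).
case/and3P=> /andP[exw xwW] /andP[ewt _] pth.
case/and3P=> xwt _ unip sz xA lA.
have xt : x != t by apply: contraNneq xwt => ->; rewrite !inE eqxx orbT.
have wA : w \in A by have := eA _ _ exw; rewrite (negPf xA); case: (w \in A).
have tA : t \notin A by have := eA _ _ ewt; rewrite wA; case: (t \in A).
have WsubA y : y \in W -> y \in A by move/(subsetP WA); rewrite inE => /andP[].
have wW : w \in W.
  by case/orP: xwW => // /WsubA xA'; rewrite xA' in xA.
have szp : size p < n by move: sz; clear; lia.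
have [IH1 IH2 IH3] := IHn t p pth unip szp tA lA.
split.
- move=> y; rewrite !inE => /or3P[/eqP->//|/eqP->|yp]; last exact: IH1.
  by move=> tA'; rewrite tA' in tA.
- by rewrite negbK.
have degw : degree e w = 2.
  by have := subsetP WA w wW; rewrite inE => /andP[_ /eqP].
have : f x != f t.
  apply: (fW w) => //; apply: degree2_neighbours => //; first by rewrite e_sym.
by rewrite /= IH3; case: (f x); case: (f t); case: (odd _).
Qed.

(** The vertices [w] of degree 2 in [A] are handled one by one. If the
    neighbours [u] and [u'] of [w] have got the same colour, exchange the two
    colours on the component of [u] in the graph formed by the edges at the
    vertices handled so far. This component does not contain [u']: a path from
    [u] to [u'] in this graph would alternate, so its length would be a multiple
    of 4, and closing it through [w] would give a cycle of length 2 modulo 4. *)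
Lemma separating_colouring e A : symmetric e -> in_H e -> crosses e A ->
  exists f, separates e A f.
Proof.
move=> e_sym eH eA; pose W0 := [set w in A | degree e w == 2].
suff [f fP] : exists f, separates e W0 f.
  exists f => w u u' wA uu' Nw; apply: fP (uu') (Nw).
  by rewrite inE wA (neighbours_degree2 uu' Nw).
suff main n (W : {set T}) :
    #|W| <= n -> W \subset W0 -> exists f, separates e W f.
  exact: main (leqnn _) (subxx _).
elim: n W => [|n IHn] W.
  rewrite leqn0 cards_eq0 => /eqP-> _; exists (fun=> true) => w u u'.
  by rewrite inE.
have [->|[w wW]] := set_0Vmem W.
  by move=> _ _; exists (fun=> true) => w u u'; rewrite inE.
rewrite (cardsD1 w) wW ltnS => cW WW0.
have W'W0 : W :\ w \subset W0 by apply: subset_trans WW0; apply: subsetDl.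
have [f fW'] := IHn _ cW W'W0.
have [wA degw] : w \in A /\ degree e w = 2.
  by have := subsetP WW0 w wW; rewrite inE => /andP[-> /eqP].
have [u [u' [uu' Nw]]] : exists u u', u != u' /\ [set z | e w z] = [set u; u'].
  by apply/cards2P; rewrite -degw.
have [ewu ewu'] : e w u /\ e w u'.
  have eE z : e w z = (z \in [set u; u']) by rewrite -Nw inE.
  by rewrite !eE !inE !eqxx orbT.
have WE g : separates e (W :\ w) g -> g u != g u' -> separates e W g.
  move=> gW' guu' w1 t t' w1W tt' Nw1.
  have [w1w|w1w] := eqVneq w1 w; last first.
    by apply: (gW' w1) => //; rewrite !inE w1w.
  have : t \in [set u; u'] by rewrite -Nw -w1w Nw1 !inE eqxx.
  have : t' \in [set u; u'] by rewrite -Nw -w1w Nw1 !inE eqxx orbT.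
  rewrite !inE => /orP[] /eqP t'E /orP[] /eqP tE;
    move: tt' guu'; rewrite tE t'E ?eqxx //.
  by move=> _; rewrite eq_sym.
have [fuu'|fuu'] := boolP (f u != f u'); first by exists f; apply: WE.
pose r := [rel y z | e y z && ((y \in W :\ w) || (z \in W :\ w))].
have r_sym : connect_sym r.
  by apply: sym_connect_sym => y z; rewrite /r /= e_sym orbC.
have [|nuu'] := boolP (connect r u u'); last first.
  exists (fun y => f y (+) connect r u y); apply: WE.
    move=> w1 t t' w1W tt' Nw1.
    have eE z : e w1 z = (z \in [set t; t']) by rewrite -Nw1 inE.
    have conn z : e w1 z -> connect r u z = connect r u w1.
      move=> ez; apply/esym; apply: (same_connect_r r_sym).
      by apply: connect1; rewrite /r /= ez w1W.
    rewrite !conn ?eE ?inE ?eqxx ?orbT //.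
    have := fW' w1 t t' w1W tt' Nw1.
    by case: (f t); case: (f t'); case: connect.
  by rewrite connect0 (negPf nuu'); move: fuu'; case: (f u); case: (f u').
case/connectP=> p0 /shortenP[p pth unip _] u'E.
have uA : u \notin A by have := eA _ _ ewu; rewrite wA; case: (u \in A).
have u'A : u' \notin A by have := eA _ _ ewu'; rewrite wA; case: (u' \in A).
have lA : last u p \notin A by rewrite -u'E.
have [pW sz fp] :=
  alternation_along_path e_sym eA W'W0 fW' pth unip uA lA.
have cycP : is_cycle e (w :: u :: p).
  split; last first.
    by case: (p) u'E => //= u'u; rewrite u'u eqxx in uu'.
  apply/andP; split.
    rewrite /= ewu rcons_path -u'E e_sym ewu' andbT.
    by apply: sub_path pth => y z /andP[].
  rewrite cons_uniq unip andbT inE negb_or; apply/andP; split.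
    by apply: contraNneq uA => <-.
  by apply/negP => /pW/(_ wA); rewrite !inE eqxx.
have := eH _ cycP; move: fuu' sz fp; rewrite -u'E /= negbK => /eqP->.
move: (f u') (size p) => k m; clear.
case: k => /=; case: (boolP (odd m./2)) => //=; lia.
Qed.

(** * Colourings without monochromatic cycles *)

Definition join A a b (w : T) : bool := if w \in A then a w else b w.

Definition good e A a b := separates e A b /\
  forall c, is_cycle e c -> ~~ constant [seq join A a b w | w <- c].

Lemma constant_map_eq (f : T -> bool) c :
  constant [seq f w | w <- c] -> {in c &, forall y z, f y = f z}.
Proof.
case: c => // x c /=; rewrite all_map => /allP fc.
have fE y : y \in x :: c -> f y = f x.
  by rewrite inE => /orP[/eqP-> // | /fc /eqP].
by move=> y z /fE-> /fE->.
Qed.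

(** Choose a separating colouring [f] with [f v = k], then recolour the free
    vertices: those outside [A], other than [v], without a neighbour of degree 2
    in [A]. No constraint bears on these, and a free vertex whose neighbours all
    have the same colour receives the opposite one. A cycle has a vertex
    [y != v] of degree 2. If [y] is in [A], its neighbours on the cycle get
    different colours; if it is not, then either it is free and differs from its
    two neighbours when these agree, or one of its neighbours is a vertex of
    degree 2 in [A]. *)
Lemma good_inseparable e A a v k :
    symmetric e -> irreflexive e -> in_H e -> crosses e A ->
    (forall D x, ~~ separation e D x) -> v \notin A ->
  exists b, good e A a b /\ b v = k.
Proof.
move=> e_sym e_irrefl eH eA e_insep vA.
have [f0 f0P] := separating_colouring e_sym eH eA.
(* Exchanging the two colours everywhere if needed gives [f v = k]. *)
pose f w := f0 w (+) (f0 v (+) k).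
have fP : separates e A f.
  move=> w u u' wA uu' Nw; have := f0P w u u' wA uu' Nw.
  by rewrite /f; case: (f0 u); case: (f0 u'); case: (_ (+) k).
pose free u := (u != v) && [forall w, e u w ==> (degree e w != 2)].
pose b u := if free u then ~~ [exists w, e u w && a w] else f u.
have bE w u : degree e w = 2 -> e w u -> b u = f u.
  move=> degw ewu; rewrite /b /free.
  case: forallP => [/(_ w)|]; last by rewrite andbF.
  by rewrite e_sym ewu degw.
have bP : separates e A b.
  move=> w u u' wA uu' Nw; have degw := neighbours_degree2 uu' Nw.
  have eE z : e w z = (z \in [set u; u']) by rewrite -Nw inE.
  by rewrite !(bE w) // ?eE ?inE ?eqxx ?orbT //; apply: fP wA uu' Nw.
exists b; split; last by rewrite /b /free eqxx /= /f addKb.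
split=> // c cycP; apply/negP => /constant_map_eq colE.
have noA y : y \in c -> y \in A -> degree e y != 2.
  move=> yc yA; apply/eqP => degy.
  have [u [u' [uc u'c uu' eyu eyu']]] := cycle_neighbours e_sym cycP yc.
  have := bP y u u' yA uu' (degree2_neighbours degy eyu eyu' uu').
  have := colE u u' uc u'c; rewrite /join.
  have := eA _ _ eyu; have := eA _ _ eyu'; rewrite yA.
  by case: (u \in A) (u' \in A) => [] [] // _ _ ->; rewrite eqxx.
have [y yc /andP[yv /eqP degy]] :=
  cycle_degree2 e_sym eH e_irrefl e_insep v cycP.
have yA : y \notin A by apply/negP => /(noA y yc); rewrite degy.
have [u [u' [uc u'c uu' eyu eyu']]] := cycle_neighbours e_sym cycP yc.
have Ny z : e y z = (z \in [set u; u']).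
  by rewrite -(degree2_neighbours degy eyu eyu' uu') inE.
have nbA z : e y z -> z \in A by move/eA; rewrite (negPf yA); case: (z \in A).
have uA := nbA u eyu; have u'A := nbA u' eyu'.
have y_free : free y.
  rewrite /free yv; apply/forallP => w; apply/implyP.
  by rewrite Ny !inE => /orP[] /eqP ->; apply: noA.
have au : a u = b y by have := colE u y uc yc; rewrite /join uA (negPf yA).
have au' : a u' = b y by have := colE u' y u'c yc; rewrite /join u'A (negPf yA).
have : b y = ~~ b y; last by case: (b y).
rewrite {1}/b y_free; congr negb; apply/existsP/idP => [[w]|by_].
  by rewrite Ny !inE => /andP[/orP[] /eqP ->]; rewrite ?au ?au'.
by exists u; rewrite eyu au.
Qed.

(** Two parts that share at most the vertex [x]. Colour first the part that
    contains [v], then the other one with one prescribed value: the colour of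
    [x] if it is outside [A], so that the two colourings agree; if [x] is in [A]
    and has exactly one neighbour in each part, the colour opposite to that of
    its neighbour in the first part. This is why the theorem prescribes
    the colour of one vertex. *)
Lemma good_glue e e1 e2 A (D1 D2 : {set T}) x a v k :
    symmetric e -> irreflexive e -> crosses e A ->
    symmetric e1 -> symmetric e2 ->
    (forall y z, e y z = e1 y z || e2 y z) ->
    (forall y z, e1 y z -> y \in D1) -> (forall y z, e2 y z -> y \in D2) ->
    (forall y, y \in D1 -> y \in D2 -> y = x) ->
    (forall c, is_cycle e c -> is_cycle e1 c \/ is_cycle e2 c) ->
    v \in D1 -> v \notin A ->
    (forall v k, v \notin A -> exists b, good e1 A a b /\ b v = k) ->
    (forall v k, v \notin A -> exists b, good e2 A a b /\ b v = k) ->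
  exists b, good e A a b /\ b v = k.
Proof.
move=> e_sym e_irrefl eA e1_sym e2_sym eE e1D e2D D12 cycE vD vA ex1 ex2.
have [b1 [[b1P b1c] b1v]] := ex1 v k vA.
have e1D' y z : e1 y z -> z \in D1 by rewrite e1_sym; apply: e1D.
have e2D' y z : e2 y z -> z \in D2 by rewrite e2_sym; apply: e2D.
have eA' y z : y \in A -> e y z -> z \notin A.
  by move=> yA /eA; rewrite yA; case: (z \in A).
have sub1 y z : e1 y z -> e y z by rewrite eE => ->.
have sub2 y z : e2 y z -> e y z by rewrite eE => ->; rewrite orbT.
have [b2 [[b2P b2c] b2x b2N]] : exists b2, [/\ good e2 A a b2,
      x \notin A -> b2 x = b1 x
    & forall u1 u2, x \in A -> e1 x u1 -> e2 x u2 ->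
        [set z | e x z] = [set u1; u2] -> b1 u1 != b2 u2].
  have [xA|xA] := boolP (x \in A); last first.
    by have [b2 [b2P b2x]] := ex2 x (b1 x) xA; exists b2; split.
  case: (pickP [pred p : T * T | [&& e1 x p.1, e2 x p.2
                           & [set z | e x z] == [set p.1; p.2]]]).
    case=> p1 p2 /and3P[/= xp1 xp2 /eqP Nx].
    have p2A : p2 \notin A by apply: eA' xA (sub2 _ _ xp2).
    have [b2 [b2P b2p]] := ex2 p2 (~~ b1 p1) p2A; exists b2; split=> //.
    have nloop u : e1 x u -> e2 x u -> False.
      move=> xu1 xu2; have ux : u = x := D12 u (e1D' _ _ xu1) (e2D' _ _ xu2).
      by have := sub1 _ _ xu1; rewrite ux e_irrefl.
    move=> u1 u2 _ xu1 xu2 _.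
    have : u1 \in [set p1; p2] by rewrite -Nx inE sub1.
    have : u2 \in [set p1; p2] by rewrite -Nx inE sub2.
    rewrite !inE => /orP[] /eqP u2E.
      by case: (nloop p1) => //; rewrite -u2E.
    case/orP=> /eqP u1E; last by case: (nloop p2) => //; rewrite -u1E.
    by rewrite u1E u2E b2p; case: (b1 p1).
  move=> none; have [b2 [b2P _]] := ex2 v k vA; exists b2.
  split=> // u1 u2 _ xu1 xu2 Nx.
  by have := none (u1, u2); rewrite /= xu1 xu2 Nx eqxx.
pose b w := if w \in D1 then b1 w else b2 w.
have bD1 w : w \in D1 -> b w = b1 w by rewrite /b => ->.
have bD2 w : w \in D2 -> w \notin A -> b w = b2 w.
  rewrite /b; case: ifP => // wD1 wD2 wA; have wx := D12 w wD1 wD2.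
  by rewrite wx in wA *; rewrite b2x.
exists b; split; last by rewrite bD1.
split=> [w u u' wA uu' Nw | c cycP].
  have nE z : e w z = (z \in [set u; u']) by rewrite -Nw inE.
  have ewu : e w u by rewrite nE !inE eqxx.
  have ewu' : e w u' by rewrite nE !inE eqxx orbT.
  have uA : u \notin A := eA' _ _ wA ewu.
  have u'A : u' \notin A := eA' _ _ wA ewu'.
  have N' e' : subrel e' e -> e' w u -> e' w u' ->
      [set z | e' w z] = [set u; u'].
    move=> sub eu eu'; apply/setP => z; rewrite inE; apply/idP/idP => [/sub|].
      by rewrite nE.
    by rewrite !inE => /orP[] /eqP ->.
  move: (ewu) (ewu'); rewrite !eE => /orP[] wu /orP[] wu'.
  - rewrite !bD1 ?(e1D' w) //; apply: b1P wA uu' (N' _ sub1 wu wu').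
  - have wx : w = x := D12 w (e1D _ _ wu) (e2D _ _ wu').
    rewrite bD1 ?(e1D' w) // bD2 ?(e2D' w) //; rewrite wx in wA wu wu' Nw.
    exact: b2N.
  - have wx : w = x := D12 w (e1D _ _ wu') (e2D _ _ wu).
    rewrite eq_sym (bD1 u') ?(e1D' w) // bD2 ?(e2D' w) //.
    rewrite wx in wA wu wu' Nw; apply: b2N => //; by rewrite Nw setUC.
  - rewrite !bD2 ?(e2D' w) //; apply: b2P wA uu' (N' _ sub2 wu wu').
case: (cycE c cycP) => cycP'.
  have -> : [seq join A a b w | w <- c] = [seq join A a b1 w | w <- c].
    apply/eq_in_map => w wc; rewrite /join bD1 //.
    by have [u [u' [_ _ _ /e1D]]] := cycle_neighbours e1_sym cycP' wc.
  exact: b1c.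
have -> : [seq join A a b w | w <- c] = [seq join A a b2 w | w <- c].
  apply/eq_in_map => w wc; rewrite /join; case: ifPn => // wA; rewrite bD2 //.
  by have [u [u' [_ _ _ /e2D]]] := cycle_neighbours e2_sym cycP' wc.
exact: b2c.
Qed.

Lemma separation_closed e D x y z : separation e D x ->
  y \in D -> e y z -> (z \in D) || (z == x).
Proof.
case/and4P=> _ /forall_inP clD _ _ yD eyz.
by have /forallP/(_ z) := clD y yD; rewrite eyz.
Qed.

(** A cycle passes at most once through [x], and away from [x] it cannot change
    sides. *)
Lemma separation_cycle e D x c :
    irreflexive e -> symmetric e -> separation e D x -> is_cycle e c ->
  is_cycle [rel y z | e y z && ((y \in D) || (z \in D))] c \/
  is_cycle [rel y z | e y z && ((y \notin D) && (z \notin D))] c.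
Proof.
move=> e_irrefl e_sym sep cycP.
have closedD y z := @separation_closed e D x y z sep.
have same y z : y != x -> z != x -> e y z -> (y \in D) = (z \in D).
  move=> yx zx eyz; apply/idP/idP => [yD|zD].
    by have := closedD y z yD eyz; rewrite (negPf zx) orbF.
  by have := closedD z y zD; rewrite e_sym (negPf yx) orbF => /(_ eyz).
have path_same y p : path e y p -> x \notin y :: p ->
    {in y :: p, forall w, (w \in D) = (y \in D)}.
  elim: p y => [|z p IHp] y /=; first by move=> _ _ w; rewrite inE => /eqP->.
  move=> /andP[eyz pth]; rewrite inE negb_or => /andP[xy xp] w.
  rewrite inE => /orP[/eqP-> //|wp]; rewrite (IHp z) //; apply/esym.
  apply: same eyz; rewrite eq_sym //.
  by move: xp; rewrite inE negb_or => /andP[].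
have [k kP] : exists k, {in c, forall w, w != x -> (w \in D) = k}.
  have [xc|xc] := boolP (x \in c); last first.
    case: c cycP xc => [|y p] [/andP[/= + _] _] // xyp.
    rewrite rcons_path => /andP[pth _]; exists (y \in D) => w wc _.
    exact: path_same pth xyp w wc.
  have [i [|y p] defc] := rot_to xc.
    by move: cycP; rewrite -(is_cycle_rot e i) defc => -[].
  move: cycP; rewrite -(is_cycle_rot e i) defc => -[/andP[cyc]].
  rewrite cons_uniq => /andP[xyp _] _.
  move: cyc; rewrite /= rcons_path => /andP[_ /andP[pth _]].
  exists (y \in D) => w; rewrite -(mem_rot i) defc inE => /orP[->//|wp _].
  exact: path_same pth xyp w wp.
case: cycP => /andP[cyc unic] sz.
have inD y : y \in c -> y \in D -> k.
  move=> yc yD; rewrite -(kP y yc) //; apply: contraTneq yD => ->.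
  by case/and4P: sep.
have k_in y z : y \in c -> z \in c -> e y z -> k -> (y \in D) || (z \in D).
  move=> yc zc eyz kt; have [yx|yx] := eqVneq y x; last by rewrite (kP y) // kt.
  rewrite (kP z) ?kt ?orbT //; apply: contraTneq eyz => zx.
  by rewrite yx zx e_irrefl.
case: (boolP k) => kt; [left | right]; split=> //; apply/andP; split=> //.
  apply: (sub_in_cycle (P := mem c)) (allss c) cyc => y z yc zc eyz /=.
  by rewrite eyz k_in.
apply: (sub_in_cycle (P := mem c)) (allss c) cyc => y z yc zc eyz /=.
by rewrite eyz /=; apply/andP; split; apply: contra kt; apply: inD.
Qed.

(** Induction on the number of edges, gluing along a separation if there is
    one. *)
Lemma good_exists e A a v k :
    symmetric e -> irreflexive e -> in_H e -> crosses e A -> v \notin A ->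
  exists b, good e A a b /\ b v = k.
Proof.
pose edges e := [set p : T * T | e p.1 p.2].
have [n] := ubnP #|edges e|; elim: n e v k => // n IHn e v k edges_n.
move=> e_sym e_irrefl eH eA vA.
have [|insep] := boolP [exists D, exists x, separation e D x]; last first.
  apply: good_inseparable => // D x; apply: contraNN insep => sep.
  by apply/existsP; exists D; apply/existsP; exists x.
case/existsP=> D /existsP[x sep].
pose e1 := [rel y z | e y z && ((y \in D) || (z \in D))].
pose e2 := [rel y z | e y z && ((y \notin D) && (z \notin D))].
have e1_sym : symmetric e1 by move=> y z; rewrite /= e_sym orbC.
have e2_sym : symmetric e2.
  by move=> y z; rewrite /= e_sym [(_ \notin _) && _]andbC.
have eE y z : e y z = e1 y z || e2 y z.
  by rewrite /= -andb_orr -negb_or orbN andbT.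
have [_ _ exD exC] := and4P sep.
have IH (e' : rel T) p :
    symmetric e' -> subrel e' e -> e p.1 p.2 -> ~~ e' p.1 p.2 ->
    forall v k, v \notin A -> exists b, good e' A a b /\ b v = k.
  move=> e'_sym sub ep e'p v' k' v'A; apply: IHn => //.
  - rewrite -ltnS; apply: leq_trans edges_n.
    rewrite ltnS; apply/proper_card/properP.
    split; last by exists p; rewrite !inE.
    by apply/subsetP => q; rewrite !inE; apply: sub.
  - by move=> y; apply: contraFF (e_irrefl y); apply: sub.
  - exact: in_H_sub eH.
  - by move=> y z /sub /eA.
have ex1 : forall v k, v \notin A -> exists b, good e1 A a b /\ b v = k.
  have [y /existsP[z /and3P[yD zD eyz]]] := existsP exC.
  apply: (IH _ (y, z)) => //=; first by move=> ? ? /andP[].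
  by rewrite (negPf yD) (negPf zD) andbF.
have ex2 : forall v k, v \notin A -> exists b, good e2 A a b /\ b v = k.
  have [y /andP[yD /existsP[z eyz]]] := existsP exD.
  apply: (IH _ (y, z)) => //=; first by move=> ? ? /andP[].
  by rewrite yD andbF.
have e1D y z : e1 y z -> y \in x |: D.
  rewrite /= !inE => /andP[eyz /orP[->|zD]]; first by rewrite orbT.
  by rewrite orbC; apply: separation_closed sep zD _; rewrite e_sym.
have e2D y z : e2 y z -> y \in ~: D by rewrite /= inE => /andP[_ /andP[]].
have cycE := @separation_cycle e D x _ e_irrefl e_sym sep.
have [vD|vD] := boolP (v \in D).
  apply: (@good_glue e e1 e2 A (x |: D) (~: D) x) => //.
    by move=> y; rewrite !inE => /orP[/eqP|->].
  by rewrite !inE vD orbT.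
apply: (@good_glue e e2 e1 A (~: D) (x |: D) x) => //.
- by move=> y z; rewrite eE orbC.
- by move=> y; rewrite !inE => /negPf-> /orP[/eqP|].
- by move=> c /cycE[]; [right | left].
- by rewrite inE.
Qed.

End Colourings.

(** * The theorem *)

Lemma bipartition_crosses (T : finType) (e : rel T) (Va Vb : {set T}) :
  is_bipartition e Va Vb ->
  crosses e Va /\ (forall w, (w \in Vb) = (w \notin Va)).
Proof.
case=> cover disj indA indB.
have VbE w : (w \in Vb) = (w \notin Va).
  have := in_setT w; rewrite -cover inE; have := disjointFr disj (x := w).
  by case: (w \in Va) => [->|_] /=.
split=> // x y exy; apply/eqP => xy.
have [xA|xA] := boolP (x \in Va).
  by have := indA x y xA; rewrite -xy xA exy => /(_ isT).
by have := indB x y; rewrite !VbE -xy xA exy => /(_ isT isT).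
Qed.

Definition colour_of_bool (k : bool) : 'I_2 := if k then ord_max else ord0.

Lemma bool_of_colourK : cancel (fun i : 'I_2 => i == ord_max) colour_of_bool.
Proof.
by move=> i; apply/val_inj; rewrite /colour_of_bool; case: i => [[|[]]].
Qed.

Lemma colour_of_boolK : cancel colour_of_bool (fun i => i == ord_max).
Proof. by case. Qed.

(** Along a path with both ends outside [Va], each vertex of [Va] is inner, so
    it has degree 2 and separates its two neighbours on the path. *)
Lemma separates_alternates (T : finType) (e : rel T) (Va Vb : {set T})
    (f : T -> bool) (b : colouring Vb) (x : T) (p : seq T) :
    symmetric e -> crosses e Va -> (forall w, (w \in Vb) = (w \notin Va)) ->
    separates e Va f -> (forall u, b u = colour_of_bool (f (val u))) ->
    is_path e x p -> x \in Vb -> last x p \in Vb ->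
    (forall w, w \in inner_vertices x p -> degree e w = 2) ->
  alternates_along b x p.
Proof.
move=> e_sym eA VbE fP bE; have [n] := ubnP (size p).
elim: n x p => // n IHn x [|w [|t p]] sz [/= pth unip] xB lB inner.
- by rewrite /alternates_along /= insubT.
- move: pth xB lB; rewrite andbT !VbE => /eA.
  by case: (x \in Va); case: (w \in Va).
have /and3P[exw ewt tp] := pth; have /and3P[xwt _ unitp] := unip.
have wA : w \in Va.
  have := eA _ _ exw; rewrite VbE in xB.
  by rewrite (negPf xB); case: (w \in Va).
have tA : t \notin Va by have := eA _ _ ewt; rewrite wA; case: (t \in Va).
have tB : t \in Vb by rewrite VbE.
have xt : x != t by apply: contraNneq xwt => ->; rewrite !inE eqxx orbT.
have szp : size p < n by move: sz => /=; clear; lia.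
have inner_t z : z \in inner_vertices t p -> degree e z = 2.
  move=> zp; apply: inner; rewrite /inner_vertices /= inE; apply/orP; right.
  exact: mem_behead.
have := IHn t p szp (conj tp unitp) tB lB inner_t.
rewrite /alternates_along /= insubT insubF; last by rewrite VbE wA.
rewrite insubT /= => ->; rewrite andbT !bE.
apply: contra_neq (fP w x t wA xt _); first exact: (can_inj colour_of_boolK).
apply: degree2_neighbours => //; last by rewrite e_sym.
by apply: inner; rewrite /inner_vertices /= mem_head.
Qed.

Theorem theorem2 (T : finType) (e : rel T)
    (e_sym : symmetric e) (e_irrefl : irreflexive e) (G_in_H : in_H e)
    (Va Vb : {set T}) (bip : is_bipartition e Va Vb)
    (v : {x : T | x \in Vb}) (c : 'I_2) (a : colouring Va) :
  exists b : colouring Vb,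
    [/\ (forall s : seq T, is_cycle e s ->
           ~ monochromatic (join_colouring a b) s),
        (forall (x : T) (p : seq T), is_path e x p ->
           x \in Vb -> last x p \in Vb ->
           (forall w : T, w \in inner_vertices x p -> degree e w = 2) ->
           alternates_along b x p)
      & b v = c].
Proof.
have [eA VbE] := bipartition_crosses bip.
pose a' w := if insub w is Some x then a x == ord_max else false.
have vA : val v \notin Va by rewrite -VbE (valP v).
have [f [[fP fc] fv]] :=
  good_exists a' (c == ord_max) e_sym e_irrefl G_in_H eA vA.
pose b : colouring Vb := fun u => colour_of_bool (f (val u)).
exists b; split; last by rewrite /b fv bool_of_colourK.
  move=> s cycs mono; have /negP := fc s cycs; apply.
  have -> : [seq join Va a' f w | w <- s] =
            [seq i == ord_max | i <- [seq join_colouring a b w | w <- s]].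
    rewrite -map_comp; apply: eq_map => w; rewrite /join /join_colouring /a' /=.
    case: insubP => [u uA uw|wA]; first by rewrite uA.
    rewrite (negPf wA); case: insubP => [u _ uw|]; last by rewrite VbE wA.
    by rewrite /b uw colour_of_boolK.
  case: s {cycs} mono => //= w s; rewrite /monochromatic /= !all_map.
  by apply: sub_all => z /= /eqP ->.
move=> x p; exact: (separates_alternates e_sym eA VbE fP).
Qed.
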